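(* Let $I_\bullet=[I_0,\dots,I_d]$ be a singular (singlestep) expression, and let $\partial_{I_\bullet}\colon R^{I_d}\to R^{I_0}$ be the associated composition of inclusion maps and Demazure trace maps. If $I_\bullet$ is a reduced expression expressing the $(I_0,I_d)$-coset $p$, then $\partial_{I_\bullet}=\partial_p$. Otherwise (if $I_\bullet$ is not reduced), $\partial_{I_\bullet}=0$.
   Context: Let $(W,S)$ be a Coxeter system with length function $\ell$ and Coxeter matrix $(m_{st})$. For $I\subset S$, $W_I$ is the subgroup generated by $I$; $I$ is finitary if $W_I$ is finite, and then $w_I$ is its longest element and $\ell(I):=\ell(w_I)$. Let $\Bbbk$ be a field. A realization is a finite-dimensional $\Bbbk$-vector space $V$ with roots $\alpha_s\in V$ and coroots $\alpha_s^\vee\in V^*$ ($s\in S$), $\langle\alpha_s^\vee,\alpha_s\rangle=2$, such that $s(v)=v-\langle\alpha_s^\vee,v\rangle\alpha_s$ defines an action of $W$ on $V$, and such that $[m_{st}]_s=[m_{st}]_t=0$ whenever $m_{st}<\infty$; here, with $a_{st}=\langle\alpha_s^\vee,\alpha_t\rangle$, $[0]_s=[0]_t=0$, $[1]_s=[1]_t=1$, $[2]_s=-a_{st}$, $[2]_t=-a_{ts}$, $[k+1]_s=[2]_s[k]_t-[k-1]_s$, $[k+1]_t=[2]_t[k]_s-[k-1]_t$. It is balanced if $[m_{st}-1]_s=[m_{st}-1]_t=1$ whenever $m_{st}<\infty$, and faithful if $W$ acts faithfully on $V$. Let $V$ be a faithful balanced realization satisfying generalized Demazure surjectivity (below). $R=\operatorname{Sym}(V)$,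 graded with $\deg V=2$; $R^I$ is the ring of $W_I$-invariants. $\partial_s\colon R\to R^s$, $\partial_s(f)=(f-s(f))/\alpha_s$; these satisfy $\partial_s^2=0$ and the braid relations, so $\partial_x:=\partial_{s_1}\cdots\partial_{s_d}$ is well defined for any reduced expression $x=s_1\cdots s_d$. Set $\partial_I:=\partial_{w_I}$ for $I$ finitary, and $\partial^I_J:=\partial_{w_Jw_I^{-1}}\colon R^I\to R^J$ for $I\subset J$ finitary. Generalized Demazure surjectivity: $\partial_I\colon R\to R^I$ is surjective for all finitary $I$. For $I,J$ finitary, an $(I,J)$-coset is an element $p\in W_I\backslash W/W_J$, regarded as a triple $(p,I,J)$; $\overline{p}$ is its maximal element in Bruhat order. $\partial_p:=\partial_{\overline{p}w_J^{-1}}$ restricted to a map $R^J\to R^I$. A (singlestep) expression is a sequence $I_\bullet=[I_0,\dots,I_d]$ of finitary subsets of $S$ such that each $I_k$ is obtained from $I_{k-1}$ by adding or removing one element of $S$. $\partial_{I_\bullet}\colon R^{I_d}\to R^{I_0}$ is the composition, over $k=d,\dots,1$ (applied in that order), of the maps $R^{I_k}\to R^{I_{k-1}}$ given by the inclusion if $I_{k-1}\subset I_k$ and by $\partial^{I_k}_{I_{k-1}}$ if $I_k\subset I_{k-1}$. Remembering local maxima and minima, $I_\bullet$ determines a multistep expression $[[I_0=J_0\subset K_1\supset J_1\subset K_2\supset\cdots\subset K_m\supset J_m=I_d]]$ (where the first and last inclusions may be equalities). The expression is reduced if the element $w=w_{K_1}w_{J_1}^{-1}w_{K_2}\cdots w_{J_{m-1}}^{-1}w_{K_m}$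 satisfies $\ell(w)=\ell(K_1)-\ell(J_1)+\ell(K_2)-\cdots-\ell(J_{m-1})+\ell(K_m)$; in this case it expresses the $(I_0,I_d)$-coset $p=W_{I_0}wW_{I_d}$. *)

(* Defs.v *)
From HB Require Import structures.
From mathcomp Require Import all_boot all_order all_algebra.
From mathcomp Require Import boolp classical_sets cardinality.
From mathcomp Require Import mpoly.

Set Implicit Arguments.
Unset Strict Implicit.
Unset Printing Implicit Defensive.

Import GRing.Theory.
Local Open Scope classical_set_scope.
Local Open Scope ring_scope.

(* A Coxeter matrix is a function m : S -> S -> nat with 0 standing for oo.
   word_eq m is the congruence on the free monoid seq S generated by
   (st)^(m s t) ~ 1; as m s s = 1 gives ss ~ 1, the quotient monoid is the
   group with generators S and relations (st)^(m s t) = 1. *)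
Inductive word_eq (S : Type) (m : S -> S -> nat) : seq S -> seq S -> Prop :=
| word_eq_rel s t : word_eq m (flatten (nseq (m s t) [:: s; t])) [::]
| word_eq_refl u : word_eq m u u
| word_eq_sym u v : word_eq m u v -> word_eq m v u
| word_eq_trans u v w : word_eq m u v -> word_eq m v w -> word_eq m u w
| word_eq_cat u u' v v' :
    word_eq m u u' -> word_eq m v v' -> word_eq m (u ++ v) (u' ++ v').

Record coxeter_system (W : groupType) (S : choiceType) := CoxeterSystem {
  cox_mx : S -> S -> nat;
  cox_gen : S -> W;
  cox_mx_diag : forall s, cox_mx s s = 1%N;
  cox_mx_sym : forall s t, cox_mx s t = cox_mx t s;
  cox_mx_offdiag : forall s t, s != t -> cox_mx s t != 1%N;
  cox_gen_surj : forall w : W, exists l : seq S, w = (\prod_(s <- l) cox_gen s)%g;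
  cox_presentation : forall l l' : seq S,
    (\prod_(s <- l) cox_gen s)%g = (\prod_(s <- l') cox_gen s)%g
      <-> word_eq cox_mx l l' }.

Section Coxeter.
Context {W : groupType} {S : choiceType} (C : coxeter_system W S).
Implicit Types (w x y t : W) (l : seq S) (I J : set S) (p : set W).

Definition word l : W := (\prod_(s <- l) cox_gen C s)%g.

Definition reduced_word l := forall l', word l' = word l -> (size l <= size l')%N.

Definition red_expr w : seq S :=
  xget [::] [set l | word l = w /\ reduced_word l].

Definition len w : nat := size (red_expr w).

Definition is_subgroup (H : set W) : Prop :=
  [/\ H 1%g, forall x y, H x -> H y -> H (x * y)%g & forall x, H x -> H x^-1%g].

Definition parabolic I : set W := smallest is_subgroup (cox_gen C @` I).

Definition finitary I : Prop := finite_set (parabolic I).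

Definition longest I : W :=
  xget 1%g [set w | parabolic I w /\
                    forall x, parabolic I x -> (len x <= len w)%N].

Definition reflection t := exists w s, t = (w * cox_gen C s * w^-1)%g.

Inductive bruhat x : W -> Prop :=
| bruhat_refl : bruhat x x
| bruhat_step y t : bruhat x y -> reflection t ->
    (len y < len (y * t)%g)%N -> bruhat x (y * t)%g.

Definition double_coset I w J : set W :=
  [set (a * w * b)%g | a in parabolic I & b in parabolic J].

Definition coset_max p : W :=
  xget 1%g [set x | p x /\ forall y, p y -> bruhat y x].

(* The expression [I_0, ..., I_d] is the nonempty sequence I0 :: Is. *)
Definition single_step I J : Prop :=
  exists s, (~ I s /\ J = I `|` [set s]) \/ (I s /\ J = I `\ s).

Fixpoint expression I0 (Is : seq (set S)) : Prop :=
  finitary I0 /\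
  if Is is I1 :: Is' then single_step I0 I1 /\ expression I1 Is' else True.

(* turning true I0 Is = [K_1; J_1; K_2; ...; J_(m-1); K_m]: the alternating
   list of local maxima and interior local minima of I0 :: Is. The flag records
   whether the path is currently going up. *)
Fixpoint turning (up : bool) I (Is : seq (set S)) : seq (set S) :=
  if Is is J :: Is' then
    let up' := `[< I `<=` J >] in
    if up' == up then turning up' J Is' else I :: turning up' J Is'
  else if up then [:: I] else [::].

Fixpoint alt_prod (KJ : seq (set S)) : W :=
  match KJ with
  | K :: J :: KJ' => (longest K * (longest J)^-1 * alt_prod KJ')%g
  | [:: K] => longest K
  | [::] => 1%g
  end.

Fixpoint alt_len (KJ : seq (set S)) : int :=
  match KJ with
  | K :: J :: KJ' =>
      (len (longest K))%:Z - (len (longest J))%:Z + alt_len KJ'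
  | [:: K] => (len (longest K))%:Z
  | [::] => 0
  end.

Definition expr_elt I0 Is : W := alt_prod (turning true I0 Is).

Definition reduced_expression I0 Is : Prop :=
  (len (expr_elt I0 Is))%:Z = alt_len (turning true I0 Is).

Definition expresses I0 Is p : Prop :=
  reduced_expression I0 Is /\ p = double_coset I0 (expr_elt I0 Is) (last I0 Is).

End Coxeter.

(* Two-colored quantum numbers: with x = [2]_s and y = [2]_t,
   [n]_s = qnum x y n and [n]_t = qnum y x n. *)
Fixpoint qnum (k : pzRingType) (x y : k) (n : nat) : k :=
  match n with
  | 0 => 0
  | n'.+1 => match n' with
             | 0 => 1
             | n''.+1 => x * qnum y x n' - qnum x y n''
             end
  end.

(* For s = t one has m s t = 1 and [1]_s = 1, so the conditions on quantum
   numbers, here and in balanced_realization, only concern s != t. *)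
Record realization (W : groupType) (S : choiceType) (C : coxeter_system W S)
    (k : fieldType) (V : vectType k) := Realization {
  simple_root : S -> V;
  simple_coroot : S -> 'Hom(V, k^o);
  wact : W -> 'End(V);
  coroot_root : forall s, simple_coroot s (simple_root s) = 2%:R;
  wact1 : wact 1%g = \1%VF;
  wactM : forall x y, wact (x * y)%g = (wact x \o wact y)%VF;
  wact_gen : forall s v, wact (cox_gen C s) v = v - (simple_coroot s v : k) *: simple_root s;
  qnum_mx : forall s t, s != t -> cox_mx C s t != 0%N ->
    let a : k := simple_coroot s (simple_root t) in
    let b : k := simple_coroot t (simple_root s) in
    qnum (- a) (- b) (cox_mx C s t) = 0 /\
    qnum (- b) (- a) (cox_mx C s t) = 0 }.

(* Sym(V), as the polynomial ring on the basis vbasis {:V} of V. *)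
Definition Sym (k : fieldType) (V : vectType k) := {mpoly k[\dim {:V}]}.

Definition in_sym (k : fieldType) (V : vectType k) (v : V) : Sym V :=
  \sum_(i < \dim {:V}) coord (vbasis {:V}) i v *: 'X_i.

Fact in_sym_is_linear (k : fieldType) (V : vectType k) : linear (@in_sym k V).
Proof.
move=> a u v; rewrite /in_sym scaler_sumr -big_split /=.
by apply: eq_bigr => i _; rewrite linearP scalerDl scalerA.
Qed.
HB.instance Definition _ (k : fieldType) (V : vectType k) :=
  GRing.isLinear.Build k V (Sym V) _ (@in_sym k V) (@in_sym_is_linear k V).

Section Realization.
Context {W : groupType} {S : choiceType} {C : coxeter_system W S}.
Context {k : fieldType} {V : vectType k} (H : realization C V).
Implicit Types (w x : W) (I J : set S) (p : set W) (f g : Sym V).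

Definition faithful_realization : Prop := injective (wact H).

Definition balanced_realization : Prop :=
  forall s t, s != t -> cox_mx C s t != 0%N ->
    let a : k := simple_coroot H s (simple_root H t) in
    let b : k := simple_coroot H t (simple_root H s) in
    qnum (- a) (- b) (cox_mx C s t).-1 = 1 /\
    qnum (- b) (- a) (cox_mx C s t).-1 = 1.

Definition sym_act w f : Sym V :=
  f \mPo [tuple in_sym (wact H w (vbasis {:V})`_i) | i < \dim {:V}].

Lemma sym_act_in_sym w v : sym_act w (in_sym v) = in_sym (wact H w v).
Proof.
rewrite {2}(coord_vbasis (memvf v)) !linear_sum /sym_act {1}/in_sym linear_sum /=.
apply: eq_bigr => i _; rewrite !linearZ /=.
by rewrite comp_mpolyXU nth_mktuple.
Qed.

Definition invariants I : set (Sym V) :=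
  [set f | forall w, parabolic C I w -> sym_act w f = f].

(* The quotient (f - s(f)) / alpha_s, as the g with alpha_s * g = f - s(f). *)
Definition demazure (s : S) f : Sym V :=
  xget 0 [set g | in_sym (simple_root H s) * g = f - sym_act (cox_gen C s) f].

(* One reduced expression of x is chosen; by the braid relations the operator
   does not depend on the choice. *)
Definition dem_elt x f : Sym V := foldr demazure f (red_expr C x).

Definition dem_finitary I : Sym V -> Sym V := dem_elt (longest C I).

Definition demazure_surjective : Prop :=
  forall I, finitary C I -> forall g, invariants I g ->
    exists f, dem_finitary I f = g.

(* The maps below are only meaningful on invariants: dem_rel I J on R^I,
   dem_coset p J on R^J, dem_step I0 I1 on R^I1, and dem_expr I0 Is on
   R^(last I0 Is). *)
Definition dem_rel I J : Sym V -> Sym V :=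
  dem_elt (longest C J * (longest C I)^-1)%g.

Definition dem_coset p J : Sym V -> Sym V :=
  dem_elt (coset_max C p * (longest C J)^-1)%g.

Definition dem_step I0 I1 f : Sym V :=
  if `[< I0 `<=` I1 >] then f else dem_rel I1 I0 f.

Fixpoint dem_expr I0 (Is : seq (set S)) f : Sym V :=
  if Is is I1 :: Is' then dem_step I0 I1 (dem_expr I1 Is' f) else f.

End Realization.

(* Main.v *)
(** Write [f = d_J g] with [J] the last set of the expression, by Demazure
    surjectivity. The composite of all maps applied to [g] is then a product of
    operators [d_x], and [d_x d_y] equals [d_(xy)] when lengths add and [0]
    otherwise: this is the dichotomy between reduced and nonreduced expressions.
    In the reduced case every element of [I_0] (resp. [J]) is a left (resp.
    right) descent of the expressed element, which is therefore Bruhat maximal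
    in its double coset.

    The multiplication rule for the [d_x] is Matsumoto's theorem together with
    [d_s d_s = 0] and the braid relations. The latter follow from the twisted
    Leibniz rule: the two alternating products [A] and [B] of length [m_st]
    satisfy the same recursion on multiplication by a linear form [v], so that
    [(A - B)(v f) = w(v) (A - B)(f)], and both kill [1]. The exchange condition
    comes from the parity of the multiplicity of a reflection among the
    inversions of a word, and the fact that [st] has order exactly [m_st] from
    the geometric representation over the algebraic numbers. *)

Require Import Defs.
From HB Require Import structures.
From mathcomp Require Import all_boot all_order all_algebra all_field.
From mathcomp Require Import boolp classical_sets cardinality.
From mathcomp Require Import mpoly.
From mathcomp Require Import zify ring.

Set Implicit Arguments.
Unset Strict Implicit.
Unset Printing Implicit Defensive.

(** * Words, inversions and the exchange condition *)

Section CoxeterWords.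
Local Open Scope group_scope.
Context {W : groupType} {S : choiceType} (C : coxeter_system W S).
Implicit Types (w x y t u v : W) (l : seq S) (s r : S).

Local Notation m := (cox_mx C).
Local Notation g := (cox_gen C).
Local Notation word := (word C).
Local Notation len := (len C).

Lemma word_nil : word [::] = 1.
Proof. exact: big_nil. Qed.

Lemma word_cons s l : word (s :: l) = g s * word l.
Proof. exact: big_cons. Qed.

Lemma word_cat l l' : word (l ++ l') = word l * word l'.
Proof. exact: big_cat. Qed.

Lemma word1 s : word [:: s] = g s.
Proof. exact: big_seq1. Qed.

Lemma word_nseq n l : word (flatten (nseq n l)) = word l ^+ n.
Proof.
by elim: n => [|n IH] /=; rewrite ?word_nil ?expg0 // word_cat IH expgS.
Qed.

Lemma word_eqP l l' : word l = word l' <-> word_eq m l l'.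
Proof. exact: cox_presentation. Qed.

Lemma genK s : g s * g s = 1.
Proof.
have := word_eq_rel m s s; rewrite cox_mx_diag /= => /word_eqP.
by rewrite word_cons word1 word_nil.
Qed.

Lemma genV s : (g s)^-1 = g s.
Proof. by apply: mulg1_eq; apply: genK. Qed.

Lemma genKl s x : g s * (g s * x) = x.
Proof. by rewrite mulgA genK mul1g. Qed.

Lemma word_rev l : word (rev l) = (word l)^-1.
Proof.
elim: l => [|s l IH]; first by rewrite word_nil invg1.
by rewrite rev_cons -cats1 word_cat word1 word_cons invgM IH genV.
Qed.

Lemma word_surj w : exists l, word l = w.
Proof. by have [l ->] := cox_gen_surj C w; exists l. Qed.

Lemma conjg_gen s t : t ^ g s = g s * t * g s.
Proof. by rewrite conjgE genV mulgA. Qed.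

(* Left inversions, in the order of the letters whose deletion they effect
   ([linv_delete]). *)
Fixpoint linv l : seq W :=
  if l is s :: l' then g s :: [seq t ^ g s | t <- linv l'] else [::].

Lemma size_linv l : size (linv l) = size l.
Proof. by elim: l => //= s l IH; rewrite size_map IH. Qed.

Lemma linv_cat l l' :
  linv (l ++ l') = linv l ++ [seq t ^ (word l)^-1 | t <- linv l'].
Proof.
elim: l => [|s l IH] /=.
  by rewrite word_nil invg1 -[LHS]map_id; apply: eq_map => t; rewrite conjg1.
rewrite IH map_cat -map_comp; congr (_ :: _ ++ _); apply: eq_map => t /=.
by rewrite word_cons invgM genV conjgM.
Qed.

(** The multiplicity of [t] in [linv l] depends on the word; its parity depends only on the element
    spelled, being a cocycle that vanishes on relators. *)
Definition inv_parity l t := odd (count_mem t (linv l)).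

Lemma count_conj u t (T : seq W) :
  count_mem t [seq x ^ u | x <- T] = count_mem (t ^ u^-1) T.
Proof.
rewrite count_map; apply: eq_count => x /=.
by rewrite -[in LHS](conjgKV u t) (inj_eq (@conjg_inj _ u)).
Qed.

Lemma inv_parity_cat l l' t :
  inv_parity (l ++ l') t = inv_parity l t (+) inv_parity l' (t ^ word l).
Proof. by rewrite /inv_parity linv_cat count_cat oddD count_conj invgK. Qed.

Lemma inv_parity1 s : inv_parity [:: s] (g s).
Proof. by rewrite /inv_parity /= eqxx. Qed.

Fixpoint alt s r n : seq S := if n is n'.+1 then s :: alt r s n' else [::].

Lemma size_alt s r n : size (alt s r n) = n.
Proof. by elim: n s r => //= n IH s r; rewrite IH. Qed.

Lemma alt_rcons s r n : alt s r n.+1 = rcons (alt s r n) (if odd n then r else s).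
Proof. by elim: n s r => //= n IH s r; rewrite if_neg -IH. Qed.

Lemma alt_nseq s r n : flatten (nseq n [:: s; r]) = alt s r n.*2.
Proof. by elim: n => //= n ->. Qed.

Lemma mulg_expg_swap x y n : x * (y * x) ^+ n = (x * y) ^+ n * x.
Proof.
elim: n => [|n IH]; first by rewrite !expg0 mulg1 mul1g.
by rewrite expgSr mulgA IH expgSr -!mulgA.
Qed.

Lemma linv_alt s r n :
  linv (alt s r n) = [seq (g s * g r) ^+ j * g s | j <- iota 0 n].
Proof.
elim: n s r => //= n IH s r; rewrite mul1g IH -map_comp (iotaDl 1 0) -map_comp.
congr (_ :: _); apply: eq_map => j /=; rewrite add1n conjg_gen mulgA.
by rewrite mulg_expg_swap expgSr -!mulgA.
Qed.

Lemma word_alt_sym s r n : word (alt s r n) = (g s * g r) ^+ n * word (alt r s n).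
Proof.
elim: n s r => [|n IH] s r /=; first by rewrite word_nil mulg1.
by rewrite !word_cons IH mulgA mulg_expg_swap expgSr -!mulgA genKl.
Qed.

Lemma gen_order s r : (g s * g r) ^+ m s r = 1.
Proof.
have := word_eq_rel m s r => /word_eqP.
by rewrite word_nseq word_nil word_cons word1.
Qed.

Lemma word_alt_braid s r : word (alt s r (m s r)) = word (alt r s (m s r)).
Proof. by rewrite word_alt_sym gen_order mul1g. Qed.

(* In a relator [(s r)^m] every inversion [(s r)^j s] occurs for two values of
   [j < 2m], since [(s r)^m = 1]. *)
Lemma inv_parity_rel s r t :
  inv_parity (flatten (nseq (m s r) [:: s; r])) t = false.
Proof.
rewrite /inv_parity alt_nseq linv_alt -addnn iotaD map_cat count_cat oddD.
rewrite [_ + _]addnC iotaDl -map_comp.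
rewrite (@eq_map _ _ _ (fun j => (g s * g r) ^+ j * g s)) ?addbb // => j /=.
by rewrite expgnDr gen_order mul1g.
Qed.

(** Induction on the congruence: relators have parity zero, and the concatenation rule is twisted by
    [word l], which is why equality of the elements is carried along. *)
Lemma inv_parity_word l l' : word l = word l' -> inv_parity l =1 inv_parity l'.
Proof.
move/word_eqP => e; suff [] : word l = word l' /\ inv_parity l =1 inv_parity l' by [].
elim: e => {l l'} [s r | u | u v _ [? e] | u v w _ [-> e] _ [-> e'] |
                  u u' v v' _ [e1 e2] _ [e3 e4]].
- split=> [|t]; first exact/word_eqP/word_eq_rel.
  by rewrite inv_parity_rel.
- by [].
- by split=> // t; rewrite e.
- by split=> // t; rewrite e e'.
- by split=> [|t]; rewrite ?word_cat ?e1 ?e3 // !inv_parity_cat e1 e2 e4.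
Qed.

Lemma gen_neq1 s : g s != 1.
Proof.
apply/eqP; rewrite -word1 -word_nil => /inv_parity_word /(_ (g s)).
by rewrite inv_parity1.
Qed.

Lemma red_exprP w : word (red_expr C w) = w /\ reduced_word C (red_expr C w).
Proof.
rewrite /red_expr; case: xgetP => [l _ // | noP].
have ex : exists n, `[< exists l, word l = w /\ size l = n >].
  by have [l e] := word_surj w; exists (size l); apply/asboolP; exists l.
case: (ex_minnP ex) => n /asboolP [l [e sz]] min; case: (noP l); split=> // l' e'.
by rewrite sz; apply: min; apply/asboolP; exists l'; rewrite e'.
Qed.

Lemma word_red_expr w : word (red_expr C w) = w.
Proof. by case: (red_exprP w). Qed.

Lemma len_le l : len (word l) <= size l.
Proof. by case: (red_exprP (word l)) => e; apply. Qed.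

Lemma reduced_wordP l : reduced_word C l <-> size l = len (word l).
Proof.
split=> [red | e l' e'].
  by apply/eqP; rewrite eqn_leq len_le red // word_red_expr.
by rewrite e -e' len_le.
Qed.

Lemma len1 : len 1 = 0.
Proof. by apply/eqP; rewrite -leqn0 -word_nil; apply: len_le. Qed.

Lemma len_mul x y : len (x * y) <= len x + len y.
Proof.
by rewrite -{1}(word_red_expr x) -{1}(word_red_expr y) -word_cat -size_cat len_le.
Qed.

Lemma lenV x : len x^-1 = len x.
Proof.
suff le y : len y^-1 <= len y by apply/eqP; rewrite eqn_leq le -{1}(invgK x) le.
by rewrite -{1}(word_red_expr y) -word_rev (leq_trans (len_le _)) // size_rev.
Qed.

Lemma len_gen s : len (g s) <= 1.
Proof. by rewrite -word1; apply: len_le. Qed.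

Lemma linv_delete l t : t \in linv l ->
  exists2 l0, size l0 < size l & t * word l = word l0.
Proof.
elim: l t => //= s l IH t; rewrite inE => /predU1P [->|/mapP [t' t'in ->]].
  by exists l => //; rewrite word_cons genKl.
have [l0 sz e] := IH _ t'in; exists (s :: l0) => //.
by rewrite !word_cons conjg_gen -e -!mulgA genKl.
Qed.

Lemma inv_parity_linv l l' t : word l' = word l -> inv_parity l' t -> t \in linv l.
Proof.
move=> e; rewrite (inv_parity_word e) -has_pred1 has_count /inv_parity.
by case: count.
Qed.

Lemma inv_parity_lt l t : inv_parity l t -> len (t * word l) < len (word l).
Proof.
move/(inv_parity_linv (esym (word_red_expr (word l))))/linv_delete => [l0 sz].
by rewrite word_red_expr => ->; apply: leq_ltn_trans (len_le _) sz.
Qed.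

Lemma reflection_gen s : reflection C (g s).
Proof. by exists 1, s; rewrite mul1g invg1 mulg1. Qed.

Lemma reflectionJ t x : reflection C t -> reflection C (t ^ x).
Proof. by move=> [w [s ->]]; exists (x^-1 * w), s; rewrite conjgE invgM invgK !mulgA. Qed.

Lemma reflectionK t : reflection C t -> t * t = 1.
Proof.
by move=> [w [s ->]]; rewrite -!mulgA mulKg (mulgA (g s)) genK mul1g mulgV.
Qed.

(** Spell [t] as a palindrome around a generator: the two halves cancel, since without the middle
    letter the word spells 1, and the middle letter counts once. *)
Lemma inv_parity_self l t : reflection C t -> word l = t -> inv_parity l t.
Proof.
move=> [w [s tE]] e; have [lw ew] := word_surj w.
have cE : t ^ w = g s by rewrite tE conjgE -!mulgA mulKg mulVg mulg1.
have el : word l = word (lw ++ ([:: s] ++ rev lw)).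
  by rewrite e !word_cat word_rev word1 ew tE mulgA.
have : inv_parity (lw ++ rev lw) t = false.
  rewrite (@inv_parity_word _ [::]) ?word_nil //.
  by rewrite word_cat word_rev mulgV.
rewrite (inv_parity_word el) !inv_parity_cat ew cE inv_parity1 word1.
by rewrite conjgE mulKg; do 2!case: inv_parity.
Qed.

(** Left multiplication by [t] toggles the parity at [t], so [t] shortens [t * word l]. *)
Lemma inv_parity_gt l t : reflection C t -> ~~ inv_parity l t ->
  len (word l) < len (t * word l).
Proof.
move=> rt inv; have [lt et] := word_surj t.
have [l' el'] := word_surj (t * word l).
have inv' : inv_parity l' t.
  rewrite (@inv_parity_word _ (lt ++ l)) ?word_cat ?et //.
  rewrite inv_parity_cat inv_parity_self // et conjgE mulKg.
  by rewrite (negbTE inv).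
by have := inv_parity_lt inv'; rewrite el' mulgA reflectionK // mul1g.
Qed.

Lemma strong_exchange l t :
  reflection C t -> len (t * word l) < len (word l) -> t \in linv l.
Proof.
move=> rt lt; case: (boolP (inv_parity l t)) => [|/(inv_parity_gt rt)].
  exact: inv_parity_linv.
by move/(ltn_trans lt); rewrite ltnn.
Qed.

(** The deleted letter lies in the prefix or in the suffix; in each use below a length count rules
    out one of the two. *)
Lemma strong_exchange_cat l l' t (w := word (l ++ l')) :
    reflection C t -> len (t * w) < len w ->
  (exists2 l0, size l0 < size l & t * word l = word l0) \/
  (exists2 l0, size l0 < size l' & t * w = word l * word l0).
Proof.
move=> rt /(strong_exchange rt); rewrite linv_cat mem_cat => /orP [/linv_delete|].
  by left.
case/mapP => t' /linv_delete [l0 sz e] ->; right; exists l0 => //.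
by rewrite -e /w word_cat conjgE invgK -!mulgA mulKg.
Qed.

Lemma len_reflection t w : reflection C t -> len (t * w) != len w.
Proof.
move=> rt; have [l <-] := word_surj w; rewrite neq_ltn.
case: (boolP (inv_parity l t)) => [/inv_parity_lt -> //|/(inv_parity_gt rt) ->].
by rewrite orbT.
Qed.
End CoxeterWords.

(** * The order of a product of two generators *)

Section GeometricRepresentation.
Local Open Scope ring_scope.
Import GRing.Theory Num.Theory.
Context {W : groupType} {S : choiceType} (C : coxeter_system W S).
Implicit Types (s r x : S) (phi : S -> algC) (l : seq S).

Local Notation m := (cox_mx C).
Local Notation g := (cox_gen C).
Local Notation word := (word C).

(** The value [n = 0] encodes infinite order and is served by [z = 2]; otherwise a primitive root of
    unity of order [2n] works. *)
Lemma ex_zeta n : exists z : algC, z != 0 /\ forall o, ((z ^+ 2) ^+ o == 1) = (n %| o)%N.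
Proof.
case: n => [|n].
  exists 2%:R; split=> [|o]; first by rewrite pnatr_eq0.
  by rewrite -exprM -natrX pnatr_eq1 -(expn0 2) eqn_exp2l // muln_eq0 dvd0n.
have [//|z prim] := @C_prim_root_exists (n.+1).*2; exists z; split=> [|o].
  apply/eqP => z0; have := prim_expr_order prim.
  by rewrite z0 expr0n /= => /eqP; rewrite eq_sym oner_eq0.
by rewrite -exprM -(prim_order_dvd prim) -mul2n dvdn_pmul2l.
Qed.

Definition zeta n : algC := projT1 (cid (ex_zeta n)).

Lemma zeta_neq0 n : zeta n != 0.
Proof. by rewrite /zeta; case: cid => z []. Qed.

Lemma zeta_order n o : ((zeta n ^+ 2) ^+ o == 1) = (n %| o)%N.
Proof. by rewrite /zeta; case: cid => z []. Qed.

(** For [z = exp(i pi / m)] the off-diagonal entry is the classical [-2 cos(pi / m)]; the proofs use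
    only that [z] is nonzero and that [z ^+ 2] has order [m]. *)
Definition cartan s r : algC :=
  if s == r then 2%:R else - (zeta (m s r) + (zeta (m s r))^-1).

(* The representation contragredient to the geometric one, written with
   [phi s = <phi, alpha_s>]; functions on [S] avoid any finiteness of [S]. *)
Definition rho phi s : S -> algC := fun x => phi x - cartan s x * phi s.

Definition rhow phi l := foldl rho phi l.

(** The coordinates [a] and [b] diagonalize the action of the pair [s], [r], with eigenvalues
    [z ^+ 2] and its inverse. *)
Lemma rhow_pair s r (a b : algC) phi (z := zeta (m s r)) : s != r ->
    phi s = a + b -> phi r = - (a / z + b * z) ->
  [/\ rhow phi [:: s; r] s = a * z ^+ 2 + b / z ^+ 2,
      rhow phi [:: s; r] r = - ((a * z ^+ 2) / z + (b / z ^+ 2) * z) &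
      forall x, rhow phi [:: s; r] x =
        phi x - cartan s x * (a + b) - cartan r x * (a * z + b / z)].
Proof.
move=> nsr es er; have zn : z != 0 by apply: zeta_neq0.
have nrs : (r == s) = false by rewrite eq_sym (negbTE nsr).
rewrite /= /rho /cartan !eqxx nrs (negbTE nsr) (cox_mx_sym C r s) -/z es er.
by split=> [||x]; field.
Qed.

Lemma rhow_pairs s r o (a b : algC) phi (z := zeta (m s r)) : s != r ->
    phi s = a + b -> phi r = - (a / z + b * z) ->
  rhow phi (flatten (nseq o [:: s; r])) s = a * (z ^+ 2) ^+ o + b / (z ^+ 2) ^+ o /\
  forall x, rhow phi (flatten (nseq o [:: s; r])) x =
    phi x - cartan s x * (a * (\sum_(j < o) (z ^+ 2) ^+ j)
                          + b * (\sum_(j < o) (z ^+ 2)^-1 ^+ j))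
          - cartan r x * (a * z * (\sum_(j < o) (z ^+ 2) ^+ j)
                          + b / z * (\sum_(j < o) (z ^+ 2)^-1 ^+ j)).
Proof.
move=> nsr; have zn : z != 0 by apply: zeta_neq0.
elim: o a b phi => [|o IH] a b phi es er.
  by split=> [|x]; rewrite ?big_ord0 /= ?es ?expr0; field.
have [es' er' e'] := rhow_pair nsr es er.
rewrite -/z in es' er' e'.
have cat l : rhow phi ([:: s; r] ++ l) = rhow (rhow phi [:: s; r]) l by [].
rewrite [nseq o.+1 _]/= [flatten _]/= cat.
have [IH1 IH2] := IH _ _ _ es' er'; split=> [|x].
  by rewrite IH1 !exprS; field; rewrite -!exprS !expf_neq0.
have sumS (w : algC) : \sum_(j < o.+1) w ^+ j = 1 + w * \sum_(j < o) w ^+ j.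
  by rewrite big_ord_recl mulr_sumr; congr (_ + _); apply: eq_bigr => j _; rewrite exprS.
by rewrite IH2 e' !sumS; field.
Qed.

(** For distinct letters both eigenvalues differ from 1 while their [m]-th powers equal 1, so the
    geometric sums of [rhow_pairs] vanish. *)
Lemma rhow_rel s r phi : rhow phi (flatten (nseq (m s r) [:: s; r])) = phi.
Proof.
have [->|nsr] := eqVneq s r.
  rewrite cox_mx_diag; apply/funext => x; rewrite /= /rho /cartan eqxx; ring.
have zn : zeta (m s r) != 0 by apply: zeta_neq0.
set z := zeta (m s r) in zn *.
have z1 : z ^+ 2 != 1.
  by rewrite -[z ^+ 2]expr1 zeta_order dvdn1 (cox_mx_offdiag C).
have zm : (z ^+ 2) ^+ m s r = 1 by apply/eqP; rewrite zeta_order.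
have geo (w : algC) : w != 1 -> w ^+ m s r = 1 -> \sum_(j < m s r) w ^+ j = 0.
  move=> w1 wm; apply/eqP; have := subrX1 w (m s r); rewrite wm subrr => /esym/eqP.
  by rewrite mulf_eq0 subr_eq0 (negbTE w1).
have zz : z - z^-1 != 0.
  apply: contra z1 => /eqP e; apply/eqP; rewrite expr2.
  by rewrite -{1}[z](subrK z^-1) e add0r mulVf.
(* The solution of [phi s = a + b], [phi r = - (a / z + b * z)], whose determinant is [z - z^-1] up
   to sign. *)
have [||_ e] := @rhow_pairs s r (m s r) ((phi s * z + phi r) / (z - z^-1))
   (phi s - (phi s * z + phi r) / (z - z^-1)) phi nsr.
- by rewrite addrC subrK.
- have zz' : z * z - 1 != 0 by rewrite -expr2 subr_eq0.
  by rewrite -/z; field; rewrite zn zz'.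
apply/funext => x; rewrite e -/z !geo ?invr_eq1 ?exprVn ?zm ?invr1 //.
by rewrite !(mulr0, addr0, subr0).
Qed.

Lemma rhow_word l l' : word l = word l' -> forall phi, rhow phi l = rhow phi l'.
Proof.
move/word_eqP; elim=> {l l'} [s r | u | u v _ e | u v w _ e _ e' |
                  u u' v v' _ e1 _ e2] phi //.
- exact: rhow_rel.
- by rewrite e e'.
- by rewrite /rhow !foldl_cat; move: (e1 phi); rewrite /rhow => ->; apply: e2.
Qed.

Lemma gen_order_dvd s r o : s != r -> ((g s * g r) ^+ o)%g = 1%g -> (m s r %| o)%N.
Proof.
move=> nsr; rewrite -[g s](word1 C) -[g r](word1 C) -word_cat -word_nseq -(word_nil C).
move/rhow_word => e; rewrite -zeta_order; set z := zeta (m s r).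
(* The eigenvector with [a = 1] and [b = 0]: each pair multiplies its value at [s] by [z ^+ 2]. *)
pose phi x : algC := if x == s then 1 else - z^-1.
have [||+ _] := @rhow_pairs s r o 1 0 phi nsr.
- by rewrite /phi eqxx addr0.
- by rewrite /phi eq_sym (negbTE nsr) mul0r addr0 mul1r.
by rewrite e /= /phi eqxx mul1r mul0r addr0 -/z => <-.
Qed.
End GeometricRepresentation.

(** * Matsumoto's theorem *)

Section Matsumoto.
Local Open Scope group_scope.
Context {W : groupType} {S : choiceType} (C : coxeter_system W S).
Implicit Types (w x y t u v : W) (l : seq S) (s r : S).

Local Notation m := (cox_mx C).
Local Notation g := (cox_gen C).
Local Notation word := (word C).
Local Notation len := (len C).
Local Notation reduced := (reduced_word C).

Lemma reduced_catr l l' : reduced (l ++ l') -> reduced l'.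
Proof.
move=> red l1 e; rewrite -(leq_add2l (size l)) -!size_cat; apply: red.
by rewrite !word_cat e.
Qed.

(** Inversions listed once have odd multiplicity, hence occur in every word for the same element,
    which bounds the size of such a word from below. *)
Lemma reduced_uniq_linv l : uniq (linv C l) -> reduced l.
Proof.
move=> un l' e; rewrite -(size_linv C) -(size_linv C l'); apply: uniq_leq_size => // t tin.
have : inv_parity C l t by rewrite /inv_parity count_uniq_mem // tin.
rewrite -(inv_parity_word e) /inv_parity -has_pred1 has_count.
by case: count.
Qed.

(** The inversions are [(sr)^j s] with [j < n], distinct as long as [n] does not exceed the exact
    order of [sr]. *)
Lemma reduced_alt s r n : s != r -> m s r = 0 \/ n <= m s r -> reduced (alt s r n).
Proof.
move=> nsr hn; apply: reduced_uniq_linv; rewrite linv_alt map_inj_in_uniq ?iota_uniq //.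
have main i j : i <= j -> j < n ->
    (g s * g r) ^+ i * g s = (g s * g r) ^+ j * g s -> i = j.
  move=> ij jn /mulIg e.
  have /(gen_order_dvd nsr) : (g s * g r) ^+ (j - i) = 1.
    by rewrite expgnFr // e mulgV.
  case: hn => [-> | le]; first by rewrite dvd0n; lia.
  move=> dv; apply/eqP; rewrite eqn_leq ij -subn_eq0; apply: contraT.
  by rewrite -lt0n => /dvdn_leq /(_ dv); lia.
move=> i j; rewrite !mem_iota !add0n /= => hi hj e.
by case: (leqP i j) => [/main -> //|/ltnW /main h]; apply/esym/h.
Qed.

(* Both [s] and [r] are left descents of [w]; the exchange condition extends
   the alternating prefix until its length is the order of [g s * g r]. *)
Lemma descents_alt s r w n : s != r ->
    len (g s * w) < len w -> len (g r * w) < len w ->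
    m s r = 0 \/ n <= m s r ->
  exists l, word (alt s r n ++ l) = w /\ size (alt s r n ++ l) = len w.
Proof.
move=> + + + hn; have {hn} : forall k, k <= n -> m s r = 0 \/ k <= m s r.
  by case: hn => [->|h] k; [left|right; lia].
elim: n s r => [|n IH] s r hn nsr ds dr.
  by exists (red_expr C w); rewrite word_red_expr.
have [||||l [lw sz]] := IH r s; rewrite 1?eq_sym //.
  by move=> k kn; rewrite (cox_mx_sym C r s); apply: hn; lia.
have := @strong_exchange_cat _ _ C (alt r s n) l _ (reflection_gen C s).
rewrite lw -word_cons => /(_ ds) [[l0 lt e]|[l0 lt e]].
  (* A deletion inside the prefix would shorten [alt s r n.+1], which is reduced. *)
  have /(_ l0 (esym e)) : reduced (alt s r n.+1) by apply: reduced_alt => //; apply: hn.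
  by move: lt; rewrite !size_alt; lia.
have e' : word (alt s r n.+1 ++ l0) = w.
  by rewrite /= word_cons word_cat -e genKl.
exists l0; split=> //; apply/eqP; rewrite eqn_leq -{2}e' len_le andbT -sz.
by rewrite !size_cat /= !size_alt addSn -addnS leq_add2l.
Qed.

Lemma descent_cons s l : reduced (s :: l) ->
  len (g s * word (s :: l)) < len (word (s :: l)).
Proof.
by move=> /reduced_wordP <-; rewrite word_cons genKl ltnS len_le.
Qed.

Context {T : Type} (op : S -> T -> T).
Hypothesis braid : forall s r, s != r -> m s r != 0 ->
  foldr op ^~ (alt s r (m s r)) =1 foldr op ^~ (alt r s (m s r)).

(** Induction on length. Distinct first letters [s] and [r] are both descents of the element, which
    therefore has reduced words starting with either alternating word of length [m s r]. Each is
    compared with the given word sharing its first letter, and the braid relation joins the two. *)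
Lemma matsumoto l l' : reduced l -> reduced l' -> word l = word l' ->
  foldr op ^~ l =1 foldr op ^~ l'.
Proof.
elim: {l}(size l) {-2}l l' (leqnn (size l)) => [|n IH] l l' sz red red' e z.
  have := red' _ e; move: sz; case: l {red e} => //= _; case: l' {red'} => //.
have szz : size l = size l'.
  by apply/eqP; rewrite eqn_leq red // red'.
case: l => [|s l] in sz red e szz *; first by case: l' szz {e red'}.
case: l' => [//|r l'] in red' e szz *.
have redl : reduced l by apply: (@reduced_catr [:: s]).
have redl' : reduced l' by apply: (@reduced_catr [:: r]).
have cancel a b : word (s :: a) = word (s :: b) -> word a = word b.
  by rewrite !word_cons => /mulgI.
have [esr|nsr] := eqVneq s r.
  rewrite -esr /=; congr op; apply: IH => //.
  by move: e; rewrite -esr !word_cons => /mulgI.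
set w := word (s :: l) in e.
have ds : len (g s * w) < len w by apply: descent_cons.
have dr : len (g r * w) < len w by rewrite e; apply: descent_cons.
have lenw : len w = (size l).+1 by move/reduced_wordP: red => <-.
(* For infinite order there would be an alternating prefix longer than [w] itself. *)
have m0 : m s r != 0.
  apply/eqP => m0; have [|l0 [_]] := @descents_alt s r w (len w).+1 nsr ds dr.
    by left.
  by rewrite size_cat size_alt; lia.
have [|l0 [wl0 sl0]] := @descents_alt s r w (m s r) nsr ds dr; first by right.
have wl0' : word (alt r s (m s r) ++ l0) = w by rewrite -wl0 !word_cat word_alt_braid.
have sl0' : size (alt r s (m s r) ++ l0) = len w by rewrite -sl0 !size_cat !size_alt.
have eq1 : foldr op z (s :: l) = foldr op z (alt s r (m s r) ++ l0).
  have red0 : reduced (alt s r (m s r) ++ l0) by apply/reduced_wordP; rewrite wl0.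
  case: (m s r) m0 wl0 red0 => // k _ wl0 red0 /=; congr op; apply: IH => //.
    exact: (@reduced_catr [:: s]).
  by move: wl0; rewrite /w /= !word_cons => /mulgI.
have eq2 : foldr op z (r :: l') = foldr op z (alt r s (m s r) ++ l0).
  have red0 : reduced (alt r s (m s r) ++ l0) by apply/reduced_wordP; rewrite wl0'.
  case: (m s r) m0 wl0' red0 => // k _ wl0' red0 /=; congr op; apply: IH => //.
  - by case: szz => <-.
  - exact: (@reduced_catr [:: r]).
  by move: wl0'; rewrite e /= !word_cons => /mulgI.
by rewrite eq1 eq2 !foldr_cat; apply: braid.
Qed.

Lemma foldr_red_expr l : reduced l ->
  foldr op ^~ (red_expr C (word l)) =1 foldr op ^~ l.
Proof.
move=> red; apply: matsumoto => //; first by case: (red_exprP C (word l)).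
exact: word_red_expr.
Qed.

Lemma foldr_mul x y z : len (x * y) = len x + len y ->
  foldr op z (red_expr C (x * y)) =
  foldr op (foldr op z (red_expr C y)) (red_expr C x).
Proof.
move=> e; rewrite -foldr_cat.
have red : reduced (red_expr C x ++ red_expr C y).
  by apply/reduced_wordP; rewrite size_cat word_cat !word_red_expr.
by have := foldr_red_expr red z; rewrite /= word_cat !word_red_expr.
Qed.

Context (z0 : T).
Hypothesis op_z0 : forall s, op s z0 = z0.
Hypothesis op_op : forall s z, op s (op s z) = z0.

(** Read from the right, the first letter that breaks reducedness is a left descent of the reduced
    suffix. Matsumoto's theorem lets that suffix be respelled to begin with this letter, and [op_op]
    applies. *)
Lemma foldr_nonreduced l z : ~ reduced l -> foldr op z l = z0.
Proof.
elim: l => [|s l IH] nred; first by case: nred => l' _.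
case: (pselect (reduced l)) => [red|/IH /= -> //].
have ds : len (g s * word l) < len (word l).
  rewrite ltn_neqAle (len_reflection _ (reflection_gen C s)).
  rewrite leqNgt; apply/negP => gt; apply: nred; apply/reduced_wordP.
  apply/eqP; rewrite eqn_leq len_le andbT word_cons (leq_trans _ gt) //.
  by move/reduced_wordP: red => /= ->.
have wE : word (s :: red_expr C (g s * word l)) = word l.
  by rewrite word_cons word_red_expr genKl.
have red' : reduced (s :: red_expr C (g s * word l)).
  apply/reduced_wordP/eqP; rewrite eqn_leq len_le andbT wE.
  by apply: leq_ltn_trans ds.
by rewrite /= (matsumoto red red' (esym wE)) /= op_op.
Qed.

Lemma foldr_mul0 x y z : len (x * y) <> len x + len y ->
  foldr op (foldr op z (red_expr C y)) (red_expr C x) = z0.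
Proof.
move=> ne; rewrite -foldr_cat foldr_nonreduced // => /reduced_wordP.
by rewrite size_cat word_cat !word_red_expr => /esym.
Qed.
End Matsumoto.

(** * Bruhat order and parabolic subgroups *)

Section Bruhat.
Local Open Scope group_scope.
Context {W : groupType} {S : choiceType} (C : coxeter_system W S).
Implicit Types (w x y z t u v : W) (l : seq S) (s r : S).

Local Notation g := (cox_gen C).
Local Notation word := (word C).
Local Notation len := (len C).
Local Notation bruhat := (bruhat C).

Lemma len_reflectionr t w : reflection C t -> len (w * t) != len w.
Proof.
move=> rt; have := len_reflection w (reflectionJ w^-1 rt).
by rewrite conjgE invgK -!mulgA mulVg mulg1.
Qed.

Lemma bruhat_trans x y z : bruhat x y -> bruhat y z -> bruhat x z.
Proof. by move=> xy; elim=> // y' t _ IH rt lt; apply: bruhat_step. Qed.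

Lemma bruhat_reflection y t : reflection C t -> len y < len (y * t) -> bruhat y (y * t).
Proof. by move=> rt; apply: bruhat_step => //; apply: bruhat_refl. Qed.

Lemma bruhat_descent s y : len (g s * y) < len y -> bruhat (g s * y) y.
Proof.
have e : g s * y * (g s) ^ y = y by rewrite conjgE -[LHS]mulgA mulVKg genKl.
move=> lt; rewrite -{2}e; apply: bruhat_reflection; last by rewrite e.
exact/reflectionJ/reflection_gen.
Qed.

Lemma bruhatV x y : bruhat x y -> bruhat x^-1 y^-1.
Proof.
elim=> [|y' t _ IH rt lt]; first exact: bruhat_refl.
have e : (y' * t)^-1 = y'^-1 * t ^ y'^-1.
  by rewrite conjgE invgK invgM mulKg; congr (_ * _); apply: mulg1_eq; apply: reflectionK rt.
rewrite e; apply: bruhat_step => //; first exact: reflectionJ.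
by rewrite -e !lenV.
Qed.

Lemma bruhat_len x y : bruhat x y -> x = y \/ len x < len y.
Proof.
elim=> [|y' t _ IH rt lt]; first by left.
by right; case: IH => [->|/ltn_trans]; last apply.
Qed.

(** The lifting property, by induction along the chain from [x] to [y]. In the delicate case [s]
    lengthens [y'] but [s y' t] is shorter than [s y']; exchange then forces [s y' = y' t]. *)
Lemma bruhat_lift s x y : bruhat x y -> bruhat (g s * x) y \/ bruhat (g s * x) (g s * y).
Proof.
elim=> [|y' t _ IH rt lt]; first by right; apply: bruhat_refl.
case: IH => [h|h]; first by left; apply: bruhat_step.
have [lt'|] := ltnP (len (g s * y')) (len (g s * (y' * t))).
  by right; rewrite mulgA; apply: bruhat_step; rewrite // -mulgA.
rewrite leq_eqVlt mulgA (negbTE (len_reflectionr _ rt)) /= => gt; left.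
have [ltl|gel] := ltnP (len (g s * y')) (len y').
  apply: bruhat_trans h _; apply: bruhat_trans (bruhat_descent ltl) _.
  exact: bruhat_reflection.
suff <- : g s * y' = y' * t by [].
have rt' := reflectionJ (g s * y')^-1 rt.
have eE : t ^ (g s * y')^-1 * (g s * y') = g s * y' * t by rewrite conjgE invgK -!mulgA mulVg mulg1.
have := @strong_exchange_cat _ _ C [:: s] (red_expr C y') _ rt'.
rewrite word_cat word1 word_red_expr eE => /(_ gt) [[[|//] _ e]|[l0 lt0]].
  move: eE; rewrite mulgA e word_nil mul1g -mulgA => {1}->.
  by rewrite genKl.
(* Deleting a letter of [y'] would make [y' * t] shorter than [y']. *)
rewrite -mulgA => /mulgI e; move: lt; rewrite e ltnNge.
by rewrite (leq_trans (len_le C _)) // ltnW.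
Qed.

Lemma bruhat_descent_closed s x y : len (g s * y) < len y -> bruhat x y -> bruhat (g s * x) y.
Proof.
move=> lt /(bruhat_lift s) [//|h].
exact: bruhat_trans h (bruhat_descent lt).
Qed.
End Bruhat.

(** * Parabolic subgroups, longest elements and maxima of double cosets *)

Section Parabolic.
Local Open Scope group_scope.
Local Open Scope classical_set_scope.
Context {W : groupType} {S : choiceType} (C : coxeter_system W S).
Implicit Types (w x y z t u v : W) (l : seq S) (s r : S) (I J : set S).

Local Notation g := (cox_gen C).
Local Notation word := (word C).
Local Notation len := (len C).
Local Notation "''W_' I" := (parabolic C I) (at level 8, I at level 2).

Lemma parabolic_subgroup I : is_subgroup 'W_I.
Proof.
split=> [M [[? ? ?] ?] // | x y hx hy M M' | x hx M M'].
  by move: (M') (hx M M') (hy M M') => -[[_ h _] _]; apply: h.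
by move: (M') (hx M M') => -[[_ _ h] _]; apply: h.
Qed.

Lemma parabolic1 I : 'W_I 1. Proof. by case: (parabolic_subgroup I). Qed.

Lemma parabolicM I x y : 'W_I x -> 'W_I y -> 'W_I (x * y).
Proof. by case: (parabolic_subgroup I) => _ h _; apply: h. Qed.

Lemma parabolicV I x : 'W_I x -> 'W_I x^-1.
Proof. by case: (parabolic_subgroup I) => _ _; apply. Qed.

Lemma parabolic_gen I s : I s -> 'W_I (g s).
Proof. by move=> Is; apply: sub_gen_smallest; exists s. Qed.

Lemma parabolic_subset I J : I `<=` J -> 'W_I `<=` 'W_J.
Proof.
by move=> IJ; apply: sub_smallest2r; [apply: parabolic_subgroup | apply: image_subset].
Qed.

Lemma parabolicP I x : 'W_I x <-> exists2 l, (forall s, s \in l -> I s) & word l = x.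
Proof.
split=> [|[l Il <-]].
  move: x; apply: smallest_sub; last first.
    by move=> _ [s Is <-]; exists [:: s]; rewrite ?word1 // => r; rewrite inE => /eqP ->.
  split=> [|x y [l Il <-] [l' Il' <-]|x [l Il <-]].
  - by exists [::]; rewrite ?word_nil.
  - exists (l ++ l'); rewrite ?word_cat // => s.
    by rewrite mem_cat => /orP [/Il|/Il'].
  by exists (rev l); rewrite ?word_rev // => s; rewrite mem_rev => /Il.
elim: l Il => [|s l IH] Il; first by rewrite word_nil; apply: parabolic1.
rewrite word_cons; apply: parabolicM.
  by apply: parabolic_gen; apply: Il; rewrite mem_head.
by apply: IH => r rl; apply: Il; rewrite inE rl orbT.
Qed.

Lemma longestP I : finitary C I ->
  'W_I (longest C I) /\ forall x, 'W_I x -> len x <= len (longest C I).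
Proof.
move=> /finite_seqP [e eE]; rewrite /longest; case: xgetP => // noP; exfalso.
have ex : exists n, `[< exists2 x, 'W_I x & len x = n >].
  by exists 0; apply/asboolP; exists 1; [apply: parabolic1 | apply: len1].
have bd n : `[< exists2 x, 'W_I x & len x = n >] -> n <= \max_(x <- e) len x.
  by move=> /asboolP [x]; rewrite eE => /= xe <-; apply: leq_bigmax_seq.
case: (ex_maxnP ex bd) => n /asboolP [x Ix lx] mx; apply: (noP x); split=> // y Iy.
by rewrite lx; apply: mx; apply/asboolP; exists y.
Qed.

(** Induction on a word of [u], moving a letter [s] from the cofactor [c] to [u]. If [s] shortens
    [u], it lengthens [c] by at most one. If it lengthens [u], maximality of [x] makes the
    reflection [u s u^-1] shorten [x], and exchange must delete a letter of [c]. *)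
Lemma len_maximal_factor I x u :
    'W_I x -> (forall y, 'W_I y -> len y <= len x) -> 'W_I u ->
  len u + len (u^-1 * x) = len x.
Proof.
move=> Ix mx /parabolicP [l Il <-] {u}.
elim/last_ind: l Il => [|l s IH] Il; first by rewrite word_nil len1 invg1 mul1g.
have Is : I s by apply: Il; rewrite mem_rcons mem_head.
have {}Il r : r \in l -> I r by move=> rl; apply: Il; rewrite mem_rcons inE rl orbT.
have {}IH := IH Il; rewrite -cats1 word_cat word1 invgM genV -mulgA.
set u := word l in IH *; set c := u^-1 * x in IH *.
have xE : u * c = x by rewrite mulVKg.
have lo : len x <= len (u * g s) + len (g s * c).
  by apply: leq_trans (len_mul C _ _); rewrite -mulgA genKl xE.
apply/eqP; rewrite eqn_leq lo andbT -IH.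
have [lt|] := ltnP (len (u * g s)) (len u).
  have := leq_trans (len_mul C (g s) c) (leq_add (len_gen C s) (leqnn _)).
  by move/(leq_add lt); rewrite addSn add1n addnS ltnS.
rewrite leq_eqVlt eq_sym (negbTE (len_reflectionr _ (reflection_gen C s))) /= => gt.
have gt1 := leq_trans (len_mul C u (g s)) (leq_add (leqnn _) (len_gen C s)).
suff lt : len (g s * c) < len c.
  by have := leq_add gt1 lt; rewrite addnS addn1 addSn ltnS.
have Iu : 'W_I u by apply/parabolicP; exists l.
set t := (g s) ^ u^-1.
have tE : t * u = u * g s by rewrite /t conjgE invgK -!mulgA mulVg mulg1.
have rt : reflection C t by apply/reflectionJ/reflection_gen.
have lt : len (t * x) < len x.
  rewrite ltn_neqAle len_reflection // mx //; apply: parabolicM => //.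
  rewrite /t conjgE invgK; apply: parabolicM => //.
  by apply: parabolicM; [apply: parabolic_gen | apply: parabolicV].
have := @strong_exchange_cat _ _ C (red_expr C u) (red_expr C c) _ rt.
rewrite word_cat !word_red_expr xE => /(_ lt) [[l0 sz]|[l0 sz]].
  rewrite tE => e; move: (leq_ltn_trans (len_le C l0) sz).
  by rewrite -e => /(ltn_trans gt); rewrite ltnn.
rewrite -{1}xE mulgA tE -mulgA => /mulgI ->.
exact: leq_ltn_trans (len_le C _) sz.
Qed.

Lemma len_longest_factor I u : finitary C I -> 'W_I u ->
  len u + len (u^-1 * longest C I) = len (longest C I).
Proof. by move=> /longestP [? ?]; apply: len_maximal_factor. Qed.

Lemma len_longest_factorr I u : finitary C I -> 'W_I u ->
  len (longest C I * u^-1) + len u = len (longest C I).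
Proof.
move=> /longestP [Iw mx] Iu.
have := @len_maximal_factor I (longest C I)^-1 u^-1.
rewrite !lenV invgK -[len (u * _)]lenV invgM invgK addnC; apply.
- exact: parabolicV.
- by [].
- exact: parabolicV.
Qed.

(** Left letters from [I] keep an element below [x] by [bruhat_descent_closed], right letters from
    [J] do so after inversion; hence the whole coset lies below [x]. The maximum is unique because
    strict comparison raises the length. *)
Lemma coset_maxE I J x :
    (forall s, I s -> len (g s * x) < len x) ->
    (forall s, J s -> len (x * g s) < len x) ->
  coset_max C (double_coset C I x J) = x.
Proof.
move=> dl dr; have px : double_coset C I x J x.
  by exists 1; [apply: parabolic1 | exists 1; [apply: parabolic1 | rewrite mul1g mulg1]].
have mx y : double_coset C I x J y -> bruhat C y x.
  move=> [a /parabolicP [la Ia <-] [b /parabolicP [lb Jb <-] <-]].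
  rewrite -mulgA; elim: la Ia => [|s la IH] Ia; last first.
    rewrite word_cons -mulgA; apply: bruhat_descent_closed.
      by apply: dl; apply: Ia; rewrite mem_head.
    by apply: IH => r rl; apply: Ia; rewrite inE rl orbT.
  rewrite word_nil mul1g; elim/last_ind: lb Jb => [|lb s IH] Jb.
    by rewrite word_nil mulg1; apply: bruhat_refl.
  rewrite -(invgK (_ * _)) -(invgK x); apply: bruhatV.
  rewrite -cats1 word_cat word1 mulgA invgM genV invgK.
  apply: bruhat_descent_closed.
    rewrite -[len (_ * _)]lenV invgM invgK genV lenV; apply: dr.
    by apply: Jb; rewrite mem_rcons mem_head.
  by apply/bruhatV/IH => r rl; apply: Jb; rewrite mem_rcons inE rl orbT.
apply: xget_unique => [//|y [py my]].
have := bruhat_len (mx _ py); have := bruhat_len (my _ px).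
by case=> [-> //|lt] [//|/(ltn_trans lt)]; rewrite ltnn.
Qed.
End Parabolic.

(** * Demazure operators *)

Section QuantumNumbers.
Local Open Scope ring_scope.
Import GRing.Theory.
Context {k : comPzRingType}.
Implicit Types x y : k.

Lemma qnumSS x y n : qnum x y n.+2 = x * qnum y x n.+1 - qnum x y n.
Proof. by []. Qed.

(** The recursion exchanges the colors at each step; this relation brings the terms in [coroot_alt]
    back to a single color. *)
Lemma qnum_swap x y n :
  (if odd n then qnum x y n = qnum y x n else y * qnum x y n = x * qnum y x n).
Proof.
suff [] : (if odd n then qnum x y n = qnum y x n else y * qnum x y n = x * qnum y x n) /\
  (if odd n.+1 then qnum x y n.+1 = qnum y x n.+1
   else y * qnum x y n.+1 = x * qnum y x n.+1) by [].
elim: n => [|n [IH1 IH2]]; first by rewrite /= !mulr0.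
split=> //; move: IH1 IH2; rewrite !oddS negbK !qnumSS.
case: (odd n); rewrite [~~ _]/= => IH1 IH2; first by rewrite IH1 -IH2.
by rewrite !mulrBr IH1 IH2 !mulrA [y * x]mulrC.
Qed.
End QuantumNumbers.

(** * The twisted Leibniz rule and the braid relations *)

Section Demazure.
Local Open Scope ring_scope.
Import GRing.Theory.
Context {W : groupType} {S : choiceType} {C : coxeter_system W S}.
Context {k : fieldType} {V : vectType k} (H : realization C V).
Implicit Types (w x : W) (s r : S) (v : V) (f h : Sym V) (l : seq S).

Local Notation m := (cox_mx C).
Local Notation g := (cox_gen C).
Local Notation word := (word C).
Local Notation root := (simple_root H).
Local Notation coroot s v := (simple_coroot H s v : k).

Lemma sym_actD w : {morph sym_act H w : f h / f + h}.
Proof. by move=> f h; rewrite /sym_act comp_mpolyD. Qed.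

Lemma sym_actB w : {morph sym_act H w : f h / f - h}.
Proof. by move=> f h; rewrite /sym_act comp_mpolyB. Qed.

Lemma sym_actZ w (c : k) f : sym_act H w (c *: f) = c *: sym_act H w f.
Proof. by rewrite /sym_act comp_mpolyZ. Qed.

Lemma sym_actM w : {morph sym_act H w : f h / f * h}.
Proof. by move=> f h; rewrite /sym_act rmorphM. Qed.

Lemma sym_act1 w : sym_act H w 1 = 1.
Proof. by rewrite /sym_act comp_mpoly1. Qed.

Lemma in_sym_eq0 v : in_sym v = 0 -> v = 0.
Proof.
move=> e; rewrite (coord_vbasis (memvf v)) big1 // => i _.
have : (in_sym v)@_U_(i) = 0 by rewrite e mcoeff0.
rewrite /in_sym raddf_sum /= (bigD1 i) //= mcoeffZ mcoeffXU eqxx mulr1.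
rewrite big1 ?addr0 => [->|j /negbTE ji]; first by rewrite scale0r.
by rewrite mcoeffZ mcoeffXU ji mulr0.
Qed.

Lemma in_sym_vbasis (i : 'I_(\dim {:V})) : in_sym (vbasis {:V})`_i = 'X_i.
Proof.
rewrite /in_sym (bigD1 i) //= coord_free ?(basis_free (vbasisP _)) // eqxx scale1r.
rewrite big1 ?addr0 // => j /negbTE ji.
by rewrite coord_free ?(basis_free (vbasisP _)) // eq_sym -val_eqE /= in ji *; rewrite ji scale0r.
Qed.

(** Monomials are products of basis vectors. This is the induction suited to operators governed by a
    Leibniz rule for vectors. *)
Lemma Sym_ind (P : Sym V -> Prop) :
    P 1 -> (forall v f, P f -> P (in_sym v * f)) ->
    (forall (c : k) f h, P f -> P h -> P (c *: f + h)) ->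
  forall f, P f.
Proof.
move=> P1 PM PL; have P0 : P 0 by rewrite -(addNr 1) -scaleN1r; apply: PL.
have PX (mm : 'X_{1..\dim {:V}}) : P 'X_[mm].
  rewrite mpolyXE_id; elim/big_rec: _ => [//|i f _ Pf].
  elim: (mm i) => [|n IH]; first by rewrite expr0 mul1r.
  by rewrite exprS -mulrA; have := PM (vbasis {:V})`_i _ IH; rewrite in_sym_vbasis.
elim/mpolyind => [//|c mm f _ _ Pf]; exact: PL.
Qed.

Lemma wact_cons s l v : wact H (g s) (wact H (word l) v) = wact H (word (s :: l)) v.
Proof. by rewrite word_cons wactM comp_lfunE. Qed.

Lemma wact_root s : wact H (g s) (root s) = - root s.
Proof.
by rewrite wact_gen coroot_root scaler_nat mulr2n opprD addrA subrr add0r.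
Qed.

Lemma in_sym_wact_gen s v :
  in_sym (wact H (g s) v) = in_sym v - coroot s v *: in_sym (root s).
Proof. by rewrite wact_gen linearB linearZ. Qed.

Hypothesis H_faithful : faithful_realization H.

(** A zero root would make [g s] act trivially, against faithfulness and [gen_neq1]. *)
Lemma root_neq0 s : in_sym (root s) != 0.
Proof.
apply/eqP => /in_sym_eq0 r0; have := gen_neq1 C s; case/eqP; apply: H_faithful.
by apply/lfunP => v; rewrite wact_gen r0 scaler0 subr0 wact1 id_lfunE.
Qed.

(** Divisibility by the root, by induction on [f]: the twisted Leibniz rule dictates the quotient
    for a product [v f]. *)
Lemma demazureP s f :
  in_sym (root s) * demazure H s f = f - sym_act H (g s) f.
Proof.
suff ex : exists h, in_sym (root s) * h = f - sym_act H (g s) f.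
  by have := xgetPex 0 ex.
elim/Sym_ind: f => [|v f [h e]|c f f' [h e] [h' e']].
- by exists 0; rewrite sym_act1 mulr0 subrr.
- exists (coroot s v *: f + in_sym (wact H (g s) v) * h).
  rewrite mulrDr mulrCA e sym_actM sym_act_in_sym in_sym_wact_gen.
  set c := coroot s v; rewrite -!mul_mpolyC; ring.
exists (c *: h + h'); rewrite mulrDr -scalerAr e e' sym_actD sym_actZ.
by rewrite scalerBr opprD addrACA.
Qed.

Lemma demazure_unique s f h :
  in_sym (root s) * h = f - sym_act H (g s) f -> demazure H s f = h.
Proof. by rewrite -demazureP => /esym/(mulfI (root_neq0 s)). Qed.

Lemma demazure_linear s (c : k) f h :
  demazure H s (c *: f + h) = c *: demazure H s f + demazure H s h.
Proof.
apply: demazure_unique; rewrite mulrDr -scalerAr !demazureP sym_actD sym_actZ.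
by rewrite scalerBr opprD addrACA.
Qed.

Lemma demazure0 s : demazure H s 0 = 0.
Proof. by have := demazure_linear s (-1) 0 0; rewrite scaleN1r addNr => ->; rewrite scaleN1r addNr. Qed.

Lemma demazure1 s : demazure H s 1 = 0.
Proof. by apply: demazure_unique; rewrite sym_act1 mulr0 subrr. Qed.

(** Both [f - s(f)] and the root change sign under [s], so their quotient is [s]-invariant. *)
Lemma demazure_demazure s f : demazure H s (demazure H s f) = 0.
Proof.
apply: demazure_unique; rewrite mulr0; apply/esym/eqP; rewrite subr_eq0 eq_sym; apply/eqP.
have := congr1 (sym_act H (g s)) (demazureP s f).
rewrite sym_actM sym_act_in_sym wact_root linearN mulNr sym_actB.
have -> : sym_act H (g s) (sym_act H (g s) f) = f.
  elim/Sym_ind: f => [|v f IH|c f h IH IH'].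
  - by rewrite !sym_act1.
  - by rewrite !sym_actM !sym_act_in_sym IH -comp_lfunE -wactM genK wact1 id_lfunE.
  - by rewrite !(sym_actD, sym_actZ) IH IH'.
move/eqP; rewrite eqr_oppLR opprB -demazureP => /eqP.
exact: (mulfI (root_neq0 s)).
Qed.

Lemma demazureM s v f :
  demazure H s (in_sym v * f) =
  coroot s v *: f + in_sym (wact H (g s) v) * demazure H s f.
Proof.
apply: demazure_unique; rewrite mulrDr mulrCA demazureP sym_actM sym_act_in_sym in_sym_wact_gen.
by set c := coroot s v; rewrite -!mul_mpolyC; ring.
Qed.

Definition dem_word l f := foldr (demazure H) f l.

Lemma dem_word_linear l (c : k) f h :
  dem_word l (c *: f + h) = c *: dem_word l f + dem_word l h.
Proof. by elim: l => //= s l ->; rewrite demazure_linear. Qed.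

Lemma demazureD s : {morph demazure H s : f h / f + h}.
Proof. by move=> f h; have := demazure_linear s 1 f h; rewrite !scale1r. Qed.

Lemma demazureZ s (c : k) f : demazure H s (c *: f) = c *: demazure H s f.
Proof. by have := demazure_linear s c f 0; rewrite demazure0 !addr0. Qed.

Lemma demazure_leibniz s v (c d : k) f1 f2 f3 : demazure H s f2 = 0 ->
  demazure H s (in_sym v * f1 + c *: f2 + d *: f3) =
  in_sym (wact H (g s) v) * demazure H s f1 + coroot s v *: f1 + d *: demazure H s f3.
Proof.
move=> e; rewrite demazureD [demazure H s (d *: f3)]demazureZ; congr (_ + _).
by rewrite demazureD demazureZ e scaler0 addr0 demazureM addrC.
Qed.

(* Twisted Leibniz rule: deleting an interior letter from an alternating word
   leaves a repeated letter, so only the deletions of the first and of the last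
   letter survive. *)
Lemma dem_alt_leibniz s r n v f :
  dem_word (alt s r n.+2) (in_sym v * f) =
    in_sym (wact H (word (alt s r n.+2)) v) * dem_word (alt s r n.+2) f
    + coroot s (wact H (word (alt r s n.+1)) v) *: dem_word (alt r s n.+1) f
    + coroot (if odd n then s else r) v *: dem_word (alt s r n.+1) f.
Proof.
elim: n s r => [|n IH] s r.
  rewrite /= demazureM demazureD demazureZ demazureM.
  rewrite word_cons wactM comp_lfunE !word1.
  by rewrite [LHS]addrC; congr (_ + _); rewrite addrC.
rewrite -[LHS]/(demazure H s (dem_word (alt r s n.+2) (in_sym v * f))) (IH r s).
rewrite demazure_leibniz; last exact: demazure_demazure.
rewrite wact_cons; congr (_ + _ *: _).
by rewrite [odd n.+1]/=; case: (odd n).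
Qed.

(** Quantum numbers arise as the coefficients of a coroot transported by an alternating word; [x] is
    [[2]_s] and [y] is [[2]_r]. *)
Lemma coroot_alt s r n v (x := - coroot s (root r)) (y := - coroot r (root s)) :
  coroot s (wact H (word (alt r s n)) v) =
    if odd n then qnum x y n * coroot s v + qnum x y n.+1 * coroot r v
    else qnum x y n.+1 * coroot s v + qnum x y n * coroot r v.
Proof.
elim: n v => [|n IH] v.
  by rewrite /= word_nil wact1 id_lfunE mul1r mul0r addr0.
have corootE a b : coroot a (wact H (g b) v) = coroot a v - coroot b v * coroot a (root b).
  by rewrite wact_gen linearB linearZ.
rewrite alt_rcons -cats1 word_cat wactM comp_lfunE word1 IH qnumSS.
have := qnum_swap x y n.+1; rewrite [odd n.+1]/=.
case: (odd n); rewrite [~~ _]/= !corootE !coroot_root => sw.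
  rewrite -sw -/y -[coroot r (root s)]opprK -/y; ring.
rewrite -sw -[coroot s (root r)]opprK -/x; ring.
Qed.

Lemma dem_word1 s l : dem_word (s :: l) 1 = 0.
Proof.
elim: l s => [|r l IH] s; first exact: demazure1.
by rewrite /dem_word /= -[demazure H r _]/(dem_word (r :: l) 1) IH demazure0.
Qed.

Hypothesis H_balanced : balanced_realization H.

Lemma dem_alt_braid s r f : s != r -> m s r != 0%N ->
  dem_word (alt s r (m s r)) f = dem_word (alt r s (m s r)) f.
Proof.
move=> nsr m0; have nrs : r != s by rewrite eq_sym.
have [n mE] : exists n, m s r = n.+2.
  move: (cox_mx_offdiag C nsr) m0; case: (m s r) => [//|[//|n]] _ _; by exists n.
have /= [q0 q0'] := qnum_mx H nsr m0.
have /= [q1 q1'] := H_balanced nsr m0.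
(* At length [m - 1 = n.+1] the two coefficients are the quantum numbers at [m - 1] and [m], that is
   1 and 0, so a single coroot survives. *)
have b1 v : coroot s (wact H (word (alt r s n.+1)) v)
    = coroot (if odd n then r else s) v.
  rewrite coroot_alt; move: q0 q1; rewrite mE [_.-1]/= => -> ->.
  by rewrite [odd n.+1]/=; case: (odd n); rewrite /= !(mul0r, mul1r, addr0, add0r).
have b2 v : coroot r (wact H (word (alt s r n.+1)) v)
    = coroot (if odd n then s else r) v.
  rewrite coroot_alt; move: q0' q1'; rewrite mE [_.-1]/= => -> ->.
  by rewrite [odd n.+1]/=; case: (odd n); rewrite /= !(mul0r, mul1r, addr0, add0r).
elim/Sym_ind: f => [|v f IH|c f h IH IH']; last by rewrite !dem_word_linear IH IH'.
  by rewrite mE !dem_word1.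
have := word_alt_braid C s r; move: IH; rewrite mE => IH we.
(* The two boundary terms for one word are now those for the other in opposite order. *)
rewrite (dem_alt_leibniz s r n v f) (dem_alt_leibniz r s n v f) b1 b2 we IH.
exact: addrAC.
Qed.
End Demazure.

(** * Singular expressions *)

Section Expressions.
Local Open Scope group_scope.
Local Open Scope classical_set_scope.
Import GRing.Theory Num.Theory.
Context {W : groupType} {S : choiceType} (C : coxeter_system W S).
Implicit Types (w x y z : W) (I J K : set S) (Is : seq (set S)).

Local Notation len := (len C).
Local Notation longest := (longest C).

Lemma len_triangle x y z : len (x^-1 * z) <= len (x^-1 * y) + len (y^-1 * z).
Proof. by apply: leq_trans (len_mul _ _ _); rewrite -mulgA mulVKg. Qed.

Lemma len_factor x y : len y <= len x + len (x^-1 * y).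
Proof. by rewrite -{1}(mulVKg x y) len_mul. Qed.

(** A form of [expr_elt] computed step by step: every downward step contributes its own quotient,
    and along a monotone descent these telescope. *)
Fixpoint path_elt I Is : W :=
  if Is is J :: Is' then
    if `[< I `<=` J >] then path_elt J Is'
    else longest I * (longest J)^-1 * path_elt J Is'
  else longest I.

Fixpoint path_len I Is : int :=
  if Is is J :: Is' then
    if `[< I `<=` J >] then path_len J Is'
    else ((len (longest I))%:Z - (len (longest J))%:Z + path_len J Is')%R
  else (len (longest I))%:Z.

Lemma expr_elt_path I Is : expr_elt C I Is = path_elt I Is.
Proof.
(* The part after a local maximum already recorded; it gives the induction a matching claim for the
   flag [false]. *)
pose tail KJ := if KJ is J :: KJ' then (longest J)^-1 * alt_prod C KJ' else 1.
have consE K KJ : alt_prod C (K :: KJ) = longest K * tail KJ.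
  by case: KJ => [|J KJ] /=; rewrite ?mulg1 ?mulgA.
rewrite /expr_elt; suff [] : alt_prod C (turning true I Is) = path_elt I Is /\
  longest I * tail (turning false I Is) = path_elt I Is by [].
elim: Is I => [|J Is IH] I; first by rewrite /= mulg1.
have [IHt IHf] := IH J; rewrite /=; case: `[< _ >] => /=; split=> //.
- by rewrite mulVKg.
- by rewrite -/(alt_prod C (I :: turning false J Is)) consE -IHf mulgA mulgVK.
- by rewrite -IHf mulgA mulgVK.
Qed.

Lemma alt_len_path I Is : alt_len C (turning true I Is) = path_len I Is.
Proof.
pose tail KJ := (if KJ is J :: KJ' then - (len (longest J))%:Z + alt_len C KJ' else 0)%R.
have consE K KJ : (alt_len C (K :: KJ) = (len (longest K))%:Z + tail KJ)%R.
  by case: KJ => [|J KJ] /=; rewrite ?addr0 ?addrA.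
suff [] : alt_len C (turning true I Is) = path_len I Is /\
  ((len (longest I))%:Z + tail (turning false I Is) = path_len I Is)%R by [].
elim: Is I => [|J Is IH] I; first by rewrite /= addr0.
have [IHt IHf] := IH J; rewrite /=; case: `[< _ >] => /=; split=> //.
- by rewrite addNKr.
- by rewrite -/(alt_len C (I :: turning false J Is)) consE -IHf addrA subrK.
- by rewrite -IHf addrA subrK.
Qed.

Lemma reduced_path I Is :
  reduced_expression C I Is <-> ((len (path_elt I Is))%:Z = path_len I Is)%R.
Proof. by rewrite /reduced_expression expr_elt_path alt_len_path. Qed.

Lemma expression_finitary I Is : expression C I Is -> finitary C I.
Proof. by case: Is => [|J Is] []. Qed.

Lemma single_step_down I J : single_step I J -> ~ I `<=` J -> J `<=` I.
Proof.
by move=> [s [[_ ->] nIJ|[_ ->] _ r []]].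
Qed.

Lemma len_longest_quot I J : finitary C I -> finitary C J -> J `<=` I ->
  len (longest I * (longest J)^-1) + len (longest J) = len (longest I).
Proof.
move=> fI /(@longestP _ _ C) [Jw _] JI; apply: len_longest_factorr => //.
exact: parabolic_subset JI _ Jw.
Qed.

(** Subadditivity of length at every step; reducedness is the equality case. *)
Lemma path_len_ge I Is : expression C I Is -> ((len (path_elt I Is))%:Z <= path_len I Is)%R.
Proof.
elim: Is I => [//|J Is IH] I [fI [st ex]] /=.
have fJ := expression_finitary ex.
case: asboolP => [_|/(single_step_down st) JI]; first exact: IH.
have := len_longest_quot fI fJ JI; have := IH _ ex.
have := len_mul C (longest I * (longest J)^-1) (path_elt J Is); lia.
Qed.

(** Equality in a sum of subadditivity bounds forces equality in each, so reducedness can be tested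
    one step at a time. *)
Lemma reduced_path_down I J Is : expression C I (J :: Is) -> ~ I `<=` J ->
    ((len (path_elt I (J :: Is)))%:Z = path_len I (J :: Is))%R <->
    ((len (path_elt J Is))%:Z = path_len J Is)%R /\
    len (longest I * (longest J)^-1 * path_elt J Is) =
    len (longest I * (longest J)^-1) + len (path_elt J Is).
Proof.
move=> [fI [st ex]] nIJ; have := single_step_down st nIJ => JI /=.
rewrite (asboolF nIJ); have := len_longest_quot fI (expression_finitary ex) JI.
have := path_len_ge ex.
have := len_mul C (longest I * (longest J)^-1) (path_elt J Is); lia.
Qed.

(** An upward step splits [longest I] off [longest J]; a downward step leaves the cofactor
    unchanged. This makes the elements of [I] left descents. *)
Lemma reduced_path_left I Is : expression C I Is ->
    ((len (path_elt I Is))%:Z = path_len I Is)%R ->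
  len (longest I) + len ((longest I)^-1 * path_elt I Is) = len (path_elt I Is).
Proof.
elim: Is I => [|J Is IH] I ex; first by rewrite mulVg len1 addn0.
have [fI [st ex']] := ex; have fJ := expression_finitary ex'.
case: (pselect (I `<=` J)) => [IJ|nIJ].
  rewrite /= (asboolT IJ) => /(IH _ ex') e.
  have [Iw _] := longestP fI.
  have f := len_longest_factor fJ (parabolic_subset IJ Iw).
  have := len_triangle (longest I) (longest J) (path_elt J Is).
  have := len_factor (longest I) (path_elt J Is); lia.
move/(reduced_path_down ex nIJ) => [/(IH _ ex') e e'].
have := len_longest_quot fI fJ (single_step_down st nIJ).
have eq : (longest I)^-1 * (longest I * (longest J)^-1 * path_elt J Is)
    = (longest J)^-1 * path_elt J Is by rewrite -mulgA mulKg.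
by rewrite /= (asboolF nIJ) eq; lia.
Qed.

(** A right factor that splits off with additive lengths survives left multiplication with additive
    lengths. *)
Lemma reduced_path_right I Is (J := last I Is) : expression C I Is ->
    ((len (path_elt I Is))%:Z = path_len I Is)%R ->
  len (path_elt I Is * (longest J)^-1) + len (longest J) = len (path_elt I Is).
Proof.
rewrite /J {J}; elim: Is I => [|J Is IH] I ex; first by rewrite /= mulgV len1.
have [fI [st ex']] := ex.
case: (pselect (I `<=` J)) => [IJ|nIJ].
  by rewrite /= (asboolT IJ); apply: IH.
move/(reduced_path_down ex nIJ) => [/(IH _ ex') e e'].
rewrite /= (asboolF nIJ) in e' *; set L := longest (last J Is) in e *.
set d := longest I * _ in e' *; set x := path_elt J Is in e e' *.
have : len (d * x) <= len (d * x * L^-1) + len L.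
  by rewrite -{1}(mulgVK L (d * x)) len_mul.
have : len (d * x * L^-1) <= len d + len (x * L^-1) by rewrite -mulgA len_mul.
lia.
Qed.

Lemma last_finitary I Is : expression C I Is -> finitary C (last I Is).
Proof. by elim: Is I => [|J Is IH] I [fI] //= [_ /IH]. Qed.

Lemma len_gen_longest I s : finitary C I -> I s ->
  len (cox_gen C s * longest I) < len (longest I).
Proof.
move=> /(@longestP _ _ C) [Iw mx] Is; rewrite ltn_neqAle.
rewrite (len_reflection _ (reflection_gen C s)) mx //.
by apply: parabolicM => //; apply: parabolic_gen.
Qed.

Lemma len_longest_gen I s : finitary C I -> I s ->
  len (longest I * cox_gen C s) < len (longest I).
Proof.
move=> /(@longestP _ _ C) [Iw mx] Is; rewrite ltn_neqAle.
rewrite (len_reflectionr _ (reflection_gen C s)) mx //.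
by apply: parabolicM => //; apply: parabolic_gen.
Qed.

Lemma coset_max_path I Is (J := last I Is) (x := path_elt I Is) : expression C I Is ->
    ((len x)%:Z = path_len I Is)%R ->
  coset_max C (double_coset C I x J) = x.
Proof.
move=> ex red; have fI := expression_finitary ex; have fJ : finitary C J := last_finitary ex.
apply: coset_maxE => s.
  move/(len_gen_longest fI) => lt; rewrite -(reduced_path_left ex red).
  have : len (cox_gen C s * x) <=
      len (cox_gen C s * longest I) + len ((longest I)^-1 * path_elt I Is).
    by rewrite /x -{1}(mulVKg (longest I) (path_elt I Is)) mulgA len_mul.
  lia.
have := reduced_path_right ex red; rewrite -/J -/x => e /(len_longest_gen fJ) lt.
have : len (x * cox_gen C s) <=
    len (x * (longest J)^-1) + len (longest J * cox_gen C s).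
  by rewrite -{1}(mulgVK (longest J) x) -mulgA len_mul.
lia.
Qed.
End Expressions.

(** * Composites of Demazure operators along an expression *)

Section DemazureExpressions.
Local Open Scope ring_scope.
Local Open Scope classical_set_scope.
Import GRing.Theory.
Context {W : groupType} {S : choiceType} {C : coxeter_system W S}.
Context {k : fieldType} {V : vectType k} (H : realization C V).
Hypotheses (H_faithful : faithful_realization H) (H_balanced : balanced_realization H).

Local Notation len := (len C).

Lemma dem_elt_mul x y f : len (x * y)%g = (len x + len y)%N ->
  dem_elt H (x * y)%g f = dem_elt H x (dem_elt H y f).
Proof.
by apply: foldr_mul => s r nsr m0 {}f; apply: dem_alt_braid.
Qed.

Lemma dem_elt_mul0 x y f : len (x * y)%g <> (len x + len y)%N ->
  dem_elt H x (dem_elt H y f) = 0.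
Proof.
apply: foldr_mul0 => [s r nsr m0 {}f|s|s {}f]; first exact: dem_alt_braid.
  exact: demazure0.
exact: demazure_demazure.
Qed.

Lemma dem_elt0 x : dem_elt H x 0 = 0.
Proof. by rewrite /dem_elt; elim: (red_expr C x) => //= s l ->; apply: demazure0. Qed.

(** The operator of the last set supplies the factor with which [path_elt] ends. Upward steps then
    change neither side, and the product rule decides each downward step. *)
Lemma dem_expr_path I Is f : expression C I Is ->
  dem_expr H I Is (dem_elt H (longest C (last I Is)) f) =
  if (len (path_elt C I Is))%:Z == path_len C I Is
  then dem_elt H (path_elt C I Is) f else 0.
Proof.
elim: Is I => [|J Is IH] I ex; first by rewrite /= eqxx.
have [fI [st ex']] := ex.
rewrite [dem_expr _ _ _ _]/= (IH _ ex') /dem_step.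
case: (pselect (I `<=` J)) => [IJ|nIJ]; first by rewrite /= (asboolT IJ).
have red := reduced_path_down ex nIJ.
rewrite (asboolF nIJ) [path_elt _ _ (_ :: _)]/= (asboolF nIJ) /dem_rel.
move: red; rewrite [path_elt _ _ (_ :: _)]/= (asboolF nIJ) => red.
have [/eqP red'|nred] := boolP (_ == path_len C J Is); last first.
  rewrite dem_elt0; case: eqP => // /red [] e _.
  by rewrite e eqxx in nred.
case: eqP => [/red [_ e]|nred'].
  by rewrite -dem_elt_mul.
by apply: dem_elt_mul0 => e; apply/nred'/red.
Qed.
End DemazureExpressions.

Theorem proposition3p17
    (W : groupType) (S : choiceType) (C : coxeter_system W S)
    (k : fieldType) (V : vectType k) (H : realization C V)
    (H_faithful : faithful_realization H) (H_balanced : balanced_realization H)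
    (H_surj : demazure_surjective H)
    (I0 : set S) (Is : seq (set S)) (I_expr : expression C I0 Is) :
  (forall p : set W, expresses C I0 Is p ->
     forall f : Sym V, invariants H (last I0 Is) f ->
       dem_expr H I0 Is f = dem_coset H p (last I0 Is) f)
  /\
  (~ reduced_expression C I0 Is ->
     forall f : Sym V, invariants H (last I0 Is) f ->
       dem_expr H I0 Is f = 0%R).
Proof.
have fJ := last_finitary I_expr; split=> [p [/reduced_path red ->] f|nred f].
  case/(H_surj _ fJ) => h <-; rewrite dem_expr_path // red eqxx.
  (* The quotient of the maximal element by [longest J], with [J] the last set, recombines with the
     operator of [J], since lengths add by [reduced_path_right]. *)
  rewrite expr_elt_path /dem_coset coset_max_path // /dem_finitary -dem_elt_mul //.
    by rewrite mulgVK.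
  by rewrite mulgVK reduced_path_right.
case/(H_surj _ fJ) => h <-; rewrite dem_expr_path //.
by case: eqP => // /reduced_path.
Qed.
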